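(* Let $\mathbf F$ be a finite field, let $k \in \mathbb N$, and let $\mathbf B$ be an $\mathbf R$-module such that $|F|$ is invertible in $\mathbf R$. Then the set $\mathcal O_{F^k,B}$ of all finitary operations from $F^k$ to $B$ is uniformly generated by $k$-ary $(\mathbf F^k,\mathbf B)$-minors.
   Context: $\mathbb N=\{1,2,\dots\}$. Rings are unital (not necessarily commutative), modules are left modules; ''$|F|$ is invertible in $\mathbf R$'' means $|F|\cdot 1_{\mathbf R}$ is a unit. $\mathbf F^k$ denotes the $k$-dimensional vector space over $\mathbf F$ (as an $\mathbf F$-module). For sets $A,B$, $\mathcal O_{A,B}=\bigcup_{m\ge 1}B^{A^m}$ is the set of all finitary operations from $A$ to $B$; for $U\subseteq\mathcal O_{A,B}$, $U^{(m)}=U\cap B^{A^m}$. A module $\mathbf A$ over a ring $\mathbf S$ is viewed as a one-sorted algebra $(A,+,0,-,(s)_{s\in S})$ with each ring element acting as a unary operation. Its $m$-ary term operations are the maps $\sum_{i=1}^m s_ix_i$ with $s_i\in S$; $\mathrm{Clo}(\mathbf A)$ is the set of all term operations. For an algebra $\mathbf A$ and $n,k',l\in\mathbb N$, $R_n^{k',l}(\mathbf A)$ is the set of all maps $r\colon A^{k'}\to A^{l}$ of the form $r=v\circ w$ with $w\colon A^{k'}\to A^n$ and $v\colon A^n\to A^l$, where each coordinate function of $w$ and of $v$ is a term operation of $\mathbf A$. A set $U\subseteq B^{A^{m}}$ is uniformly generated by $n$-ary $(\mathbf A,\mathbf B)$-minors if there are $p\in\mathbb N$, a $p$-ary term operation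 $s$ of $\mathbf B$, and $r_1,\dots,r_p\in R_n^{m,m}(\mathbf A)$ such that $f=s\circ(f\circ r_1,\dots,f\circ r_p)$ for every $f\in U$ (with $s, r_1,\dots,r_p$ not depending on $f$). A set $U\subseteq\mathcal O_{A,B}$ is uniformly generated by $n$-ary $(\mathbf A,\mathbf B)$-minors if $U^{(m)}$ is, for every $m\in\mathbb N$. Identifying $(F^k)^m$ with $F^{m\times k}$ (the $i$-th argument being the $i$-th row), the maps in $R_n^{m,m}(\mathbf F^k)$ are exactly $X\mapsto MX$ with $M\in F^{m\times m}$, $\mathrm{rk}(M)\le n$. So the claim says that for each $m$ there are coefficients $\alpha_M\in R$ with $f(X)=\sum_{\mathrm{rk}(M)\le k}\alpha_Mf(MX)$ for all $f\colon F^{m\times k}\to B$ and all $X$. *)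

(* Defs.v *)
From HB Require Import structures.
From mathcomp Require Import all_boot all_order all_algebra.

Set Implicit Arguments.
Unset Strict Implicit.
Unset Printing Implicit Defensive.

Import GRing.Theory.
Local Open Scope ring_scope.

Record algebra := MkAlgebra {
  carrier :> Type;
  op_symb : Type;
  arity : op_symb -> nat;
  interp : forall o : op_symb, {ffun 'I_(arity o) -> carrier} -> carrier
}.

Inductive term (A : algebra) (m : nat) : Type :=
| Var of 'I_m
| App (o : op_symb A) of ('I_(arity o) -> term A m).

Arguments Var {A m} i.
Arguments App {A m} o args.

Fixpoint term_eval (A : algebra) (m : nat) (t : term A m)
    (x : {ffun 'I_m -> A}) : A :=
  match t with
  | Var i => x i
  | App o args => interp [ffun i => term_eval (args i) x]
  end.

Definition term_operation (A : algebra) (m : nat)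
    (f : {ffun 'I_m -> A} -> A) : Prop :=
  exists t : term A m, forall x, f x = term_eval t x.

Inductive module_op (S : Type) := OpAdd | OpZero | OpOpp | OpScale of S.

Definition module_arity (S : Type) (o : module_op S) : nat :=
  match o with OpAdd => 2 | OpZero => 0 | OpOpp | OpScale _ => 1 end.

Definition module_interp (S : pzRingType) (A : lmodType S) (o : module_op S) :
    {ffun 'I_(module_arity o) -> A} -> A :=
  match o return {ffun 'I_(module_arity o) -> A} -> A with
  | OpAdd => fun x => x ord0 + x ord_max
  | OpZero => fun=> 0
  | OpOpp => fun x => - x ord0
  | OpScale s => fun x => s *: x ord0
  end.

Definition module_algebra (S : pzRingType) (A : lmodType S) : algebra :=
  MkAlgebra (@module_interp S A).

Arguments module_algebra S A : clear implicits.

(* [factors_through n k l r]: the map r belongs to R_n^{k,l}(A). *)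
Definition factors_through (A : algebra) (n k l : nat)
    (r : {ffun 'I_k -> A} -> {ffun 'I_l -> A}) : Prop :=
  exists (w : {ffun 'I_k -> A} -> {ffun 'I_n -> A})
         (v : {ffun 'I_n -> A} -> {ffun 'I_l -> A}),
    [/\ forall i, term_operation (fun x => w x i),
        forall i, term_operation (fun y => v y i)
      & forall x, r x = v (w x)].

(* Sets of finitary operations from A to B, sorted by arity: [U m] is the
   m-ary part of U.  Only the arities m >= 1 are meaningful. *)
Definition operation_set (A B : Type) : Type :=
  forall m : nat, ({ffun 'I_m -> A} -> B) -> Prop.

Definition all_operations (A B : Type) : operation_set A B := fun _ _ => True.

Arguments all_operations A B : clear implicits.

Definition uniformly_generated_arity (A B : algebra) (n m : nat)
    (U : ({ffun 'I_m -> A} -> B) -> Prop) : Prop :=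
  exists (p : nat) (s : {ffun 'I_p -> B} -> B)
         (r : 'I_p -> {ffun 'I_m -> A} -> {ffun 'I_m -> A}),
    [/\ (0 < p)%N, term_operation s,
        forall j, factors_through n (r j)
      & forall f, U f -> forall x, f x = s [ffun j => f (r j x)]].

Definition uniformly_generated (A B : algebra) (n : nat)
    (U : operation_set A B) : Prop :=
  forall m : nat, (0 < m)%N -> uniformly_generated_arity n (U m).

Arguments uniformly_generated A B n U : clear implicits.

Definition invertible (R : pzRingType) (a : R) : Prop :=
  exists b : R, a * b = 1 /\ b * a = 1.

Lemma term_operation_moduleP (S : pzRingType) (A : lmodType S) (m : nat)
    (f : {ffun 'I_m -> A} -> A) :
  @term_operation (module_algebra S A) m f <->
  exists s : 'I_m -> S, forall x, f x = \sum_i s i *: x i.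
Proof.
split=> [[t ft]|[s fs]].
  suff [s Hs] : exists s : 'I_m -> S,
      forall x, term_eval t x = \sum_i s i *: x i :> A.
    by exists s => x; rewrite ft Hs.
  elim: t {f ft} => [j|o args IH].
    exists (fun i => (i == j)%:R) => x /=.
    rewrite (bigD1 j) //= eqxx scale1r big1 ?addr0 // => i /negPf ->.
    exact: scale0r.
  case: o args IH => [|||a] args IH.
  - have [s0 H0] := IH ord0; have [s1 H1] := IH ord_max.
    exists (fun i => s0 i + s1 i) => x /=; rewrite !ffunE H0 H1 -big_split.
    by apply: eq_bigr => i _; rewrite scalerDl.
  - exists (fun=> 0) => x /=; rewrite big1 // => i _; exact: scale0r.
  - have [s0 H0] := IH ord0.
    exists (fun i => - s0 i) => x /=; rewrite ffunE H0 -sumrN.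
    by apply: eq_bigr => i _; rewrite scaleNr.
  - have [s0 H0] := IH ord0.
    exists (fun i => a * s0 i) => x /=; rewrite ffunE H0 scaler_sumr.
    by apply: eq_bigr => i _; rewrite scalerA.
suff [t Ht] : exists t : term (module_algebra S A) m,
    forall x, term_eval t x = \sum_i s i *: x i :> A.
  by exists t => x; rewrite Ht fs.
elim: (index_enum _) => [|i r [t Ht]].
  exists (@App (module_algebra S A) m (OpZero S)
    (fun i => Var (match i with Ordinal _ h => False_rect _ (notF h) end))).
  by move=> x; rewrite big_nil.
exists (@App (module_algebra S A) m (OpAdd S) (fun j : 'I_2 =>
  if j == ord0
  then @App (module_algebra S A) m (OpScale (s i)) (fun=> Var i)
  else t)).
by move=> x; rewrite big_cons -Ht /= !ffunE /= !ffunE.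
Qed.

(* Main.v *)
(** Write q = |F|. It suffices to find coefficients c(M), for M an m x m matrix,
    such that c(1) = 1, c(M) = 0 for every other invertible M, and
    sum_M c(M) f(MX) = 0 for all f and all m x k matrices X with k < m: this
    rewrites f(X) in terms of matrices of rank < m, and one concludes by
    descending induction on the rank.

    Let c(M) = 0 unless M is the direct sum of an identity of size a and a
    nilpotent, and put c(M) = (-1)^(m-a) q^-(a + (a+1) + ... + (m-1)) in that
    case. As X has rank < m, pX = 0 for some row p != 0, so it is enough to show
    sum_w c(M + wp) = 0, where w ranges over all columns. If the sum has a
    nonzero term, translate w so that M = N with N stable (N^(m+1) = N^m) and
    p N^m = 0; let b be the rank of N^m. The stable matrices among the N + vp are
    then of two kinds:
    - p N^j v = 0 for all j, and the stable rank is b;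
    - p v = 1, p N^j v = 0 for j > 0 and N^m v = 0, and the stable rank is b+1.
    There are q^b times as many v of the first kind as of the second, and the
    weights are chosen so that both contributions cancel. *)

Require Import Defs.
From HB Require Import structures.
From mathcomp Require Import all_boot all_order all_algebra.

Set Implicit Arguments.
Unset Strict Implicit.
Unset Printing Implicit Defensive.

Import GRing.Theory.
Local Open Scope ring_scope.

(** * Preliminaries: a recurrence, stabilizing powers, dual vectors *)

(* With T = sum t_j X^j and U = sum u_k X^k, the recurrence says (1 - X T) U = 1;
   as (1 - X) U is a polynomial, 1 - X T divides 1 - X. *)
Lemma recurrence_dichotomy (F : fieldType) (t u : nat -> F) (a b : nat) :
  (forall j, (a <= j)%N -> t j = 0) -> u 0%N = 1 ->
  (forall k, u k.+1 = \sum_(j < k.+1) t j * u (k - j)%N) ->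
  (forall k, (b <= k)%N -> u k.+1 = u k) ->
  (forall j, t j = 0) \/ (forall j, t j = (j == 0%N)%:R).
Proof.
move=> ta u0 uS ub.
pose T := \poly_(j < a) t j.
(* The coefficients of (1 - X) U, with u read as 0 at index -1; they vanish beyond b. *)
pose g k := u k - (if k is k'.+1 then u k' else 0).
pose G := \poly_(k < b.+1) g k.
have TE j : T`_j = t j by rewrite coef_poly; case: ltnP => // /ta ->.
have GE k : G`_k = g k.
  rewrite coef_poly; case: ltnP => // hk.
  by case: k hk => [//|k] /ub; rewrite /g => ->; rewrite subrr.
have E : (1 - 'X * T) * G = 1 - 'X.
  rewrite mulrBl mul1r -mulrA; apply/polyP => k.
  rewrite !coefB coefXM coef1 coefX GE.
  case: k => [|k] /=; first by rewrite /g u0 !subr0.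
  have conv : \sum_(j < k.+1) T`_j * G`_(k - j) =
      u k.+1 - (if k is k'.+1 then u k else 0).
    under eq_bigr => j _ do rewrite TE GE /g mulrBr.
    rewrite sumrB -uS; congr (_ - _).
    case: k => [|k]; first by rewrite big_ord1 mulr0.
    rewrite big_ord_recr /= subnn mulr0 addr0 uS.
    by apply: eq_bigr => j _; rewrite subSn // -ltnS.
  rewrite coefM conv /g; case: k {conv} => [|k] /=.
    by rewrite u0 subr0 addrAC subrr.
  by rewrite !subrr.
have s2 : size (1 - 'X : {poly F}) = 2%N.
  by rewrite -size_polyN opprB; exact: size_XsubC.
have /negPf nz : (1 - 'X : {poly F}) != 0 by rewrite -size_poly_eq0 s2.
have D0 : 1 - 'X * T != 0 by apply/negP => /eqP D0; rewrite -E D0 mul0r eqxx in nz.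
case: (altP (T =P 0)) => [T0|T0]; first by left=> j; rewrite -TE T0 coef0.
right=> j; rewrite -TE.
have sXT : size ('X * T) = (size T).+1 by rewrite mulrC size_mulX.
have sT : (0 < size T)%N by rewrite size_poly_gt0.
have sD : size (1 - 'X * T) = (size T).+1.
  by rewrite addrC size_polyDl size_polyN sXT // size_poly1 ltnS.
have G0 : G != 0 by apply/negP => /eqP G0; rewrite -E G0 mulr0 eqxx in nz.
have sG : (0 < size G)%N by rewrite size_poly_gt0.
(* Comparing degrees in (1 - X T) G = 1 - X forces G to be constant, hence 1, and then T = 1. *)
have := size_mul D0 G0; rewrite E s2 sD addSn /= => sz.
have /eqP sG1 : size G == 1%N.
  by rewrite eqn_leq sG andbT -(leq_add2l (size T)) -sz addn1 ltnS.
have G1 : G = 1 by rewrite (size1_polyC (eq_leq sG1)) GE /g u0 subr0.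
move: E; rewrite G1 mulr1 => /addrI /oppr_inj; rewrite -{2}['X]mulr1.
by move/(mulfI (negbT (polyX_eq0 _))) ->; rewrite coef1.
Qed.

Lemma expr_stable_leq (R : pzRingType) (x : R) (i j : nat) :
  x ^+ i.+1 = x ^+ i -> (i <= j)%N -> x ^+ j = x ^+ i.
Proof.
move=> xi /subnK <-; elim: (j - i)%N => [//|d IHd].
by rewrite addSn exprS IHd -exprS.
Qed.

(** The rank of [M ^+ i] drops until two consecutive row spaces agree, so at some i at most n+1.
    From there on all row spaces agree, so [M ^+ i] is a left multiple of [M ^+ (i + k)], which
    absorbs a further factor [M]. *)
Lemma mx_expr_stable (F : fieldType) (n : nat) (M : 'M[F]_n.+1) (k : nat) :
  M ^+ k.+1 = M ^+ k -> M ^+ n.+2 = M ^+ n.+1.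
Proof.
move=> Mk.
have [i le_i sub_i] : exists2 i, (i <= n.+1)%N & (M ^+ i <= M ^+ i.+1)%MS.
  have /(_ n.+2) [[i /ltnSE hi si]|] : forall i,
      (exists2 j, (j < i)%N & (M ^+ j <= M ^+ j.+1)%MS) \/
      (\rank (M ^+ i) + i <= n.+1)%N.
  - elim=> [|i [[j ji sj]|IHi]]; first by right; rewrite addn0 rank_leq_row.
      by left; exists j => //; apply: ltnW.
    case: (boolP (M ^+ i <= M ^+ i.+1)%MS) => si; first by left; exists i.
    right; have sub : (M ^+ i.+1 <= M ^+ i)%MS by rewrite exprS submxMl.
    apply: leq_trans IHi; rewrite addnS -addSn leq_add2r.
    by rewrite ltn_neqAle (mxrank_leqif_sup sub) si mxrankS.
  - by exists i.
  - by move/(leq_trans (leq_addl _ _)); rewrite ltnn.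
have sub_d d : (M ^+ i <= M ^+ (i + d))%MS.
  elim: d => [|d IHd]; first by rewrite addn0.
  by apply: submx_trans sub_i _; rewrite addnS !exprSr; apply: submxMr.
have Mi : M ^+ i.+1 = M ^+ i.
  have /submxP [D E] := sub_d k.
  by rewrite exprSr E -mulmxE -mulmxA mulmxE -exprSr -addnS !exprD Mk.
by rewrite !(expr_stable_leq Mi) // ltnW.
Qed.

(** Expand the power and sort the products by their leftmost factor [v *m p]. *)
Lemma exprD_sum (F : fieldType) (n : nat) (N : 'M[F]_n.+1) (v : 'cV_n.+1)
    (p : 'rV_n.+1) (k : nat) :
  (N + v *m p) ^+ k = N ^+ k +
    \sum_(0 <= i < k) N ^+ i *m v *m (p *m (N + v *m p) ^+ (k - i.+1)).
Proof.
elim: k => [|k IHk]; first by rewrite big_geq // addr0.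
rewrite exprSr {1}IHk mulrDl mulrDr -exprSr -addrA; congr (_ + _).
rewrite big_nat_recr //= subnn expr0 mulmx1 addrC -!mulmxE mulmx_suml !mulmxA.
congr (_ + _); apply: eq_big_nat => i /andP[_ ik]; rewrite -!mulmxA.
by congr (_ *m (_ *m (_ *m _))); rewrite subSn // exprSr.
Qed.

(** Some column of the cokernel of [W] pairs nontrivially with [p]; rescale it. *)
Lemma exists_dual_vector (F : fieldType) (m n : nat) (W : 'M[F]_(m, n))
    (p : 'rV_n) : ~~ (p <= W)%MS ->
  exists2 v : 'cV_n, W *m v = 0 & p *m v = 1%:M.
Proof.
rewrite submxE; move: (cokermx W) (mulmx_coker W) => C WC /rV0Pn [j hj].
exists (((p *m C) 0 j)^-1 *: col j C).
  by rewrite -scalemxAr colE mulmxA WC mul0mx scaler0.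
rewrite -scalemxAr colE mulmxA -colE; apply/matrixP => a b.
by rewrite !ord1 [LHS]mxE [in X in _ * X]mxE mulVf // !mxE.
Qed.

Lemma exists_dual_vector0 (F : fieldType) (n : nat) (p : 'rV[F]_n) : p != 0 ->
  exists v : 'cV_n, p *m v = 1%:M.
Proof.
move=> p0; have [|v _ pv] := @exists_dual_vector F n n 0 p; last by exists v.
by rewrite submx0.
Qed.

(** * Stable rank-one updates of a stable matrix *)

Section RankOneUpdate.

Variables (F : fieldType) (n : nat) (N : 'M[F]_n.+1) (p : 'rV[F]_n.+1).
Hypothesis N_stable : N ^+ n.+2 = N ^+ n.+1.
Hypothesis pN0 : p *m N ^+ n.+1 = 0.
Hypothesis p_neq0 : p != 0.

Let pNk (k : nat) : (n.+1 <= k)%N -> p *m N ^+ k = 0.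
Proof. by move=> hk; rewrite (expr_stable_leq N_stable hk). Qed.

(** A truncated geometric series, solving [eta - eta *m N = p] because [p] is killed by
    [N ^+ n.+1]. *)
Let eta := \sum_(0 <= i < n.+1) p *m N ^+ i.

Let eta_sub : eta - eta *m N = p.
Proof.
rewrite {2}/eta mulmx_suml [X in _ - X]big_nat_recr //= /eta big_nat_recl //.
rewrite expr0 mulmx1 -mulmxA [X in _ - (_ + X)](_ : _ = 0) ?addr0; last first.
  by rewrite mulmxE -exprSr.
rewrite -addrA -sumrB big1 ?addr0 // => i _.
by rewrite exprSr -mulmxE mulmxA subrr.
Qed.

Let eta_neq0 : eta != 0.
Proof.
by apply: contraNneq p_neq0 => e0; rewrite -eta_sub e0 mul0mx subr0.
Qed.

Let etaP0 : eta *m N ^+ n.+1 = 0.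
Proof.
rewrite mulmx_suml big1_seq // => i _.
by rewrite -mulmxA mulmxE -exprD pNk // leq_addl.
Qed.

(* By the Sherman-Morrison formula, sum_j (p N^j v) X^j and
   1 + sum_j (p M^j v) X^(j+1) satisfy [recurrence_dichotomy]. *)
Lemma rank_one_update_dichotomy (v : 'cV_n.+1) :
  let M := N + v *m p in M ^+ n.+2 = M ^+ n.+1 ->
  (forall j, p *m N ^+ j *m v = 0) \/
  (forall j, p *m N ^+ j *m v = (j == 0%N)%:R%:M).
Proof.
move=> M M_stable.
pose t j := (p *m N ^+ j *m v) 0 0.
pose u k := if k is k'.+1 then (p *m M ^+ k' *m v) 0 0 else 1.
have tE j : p *m N ^+ j *m v = (t j)%:M by exact: mx11_scalar.
case: (@recurrence_dichotomy F t u n.+1 n.+2) => //.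
- by move=> j hj; rewrite /t pNk // mul0mx mxE.
- move=> k; rewrite /= [in LHS]/M exprD_sum mulmxDr mulmxDl mxE addrC.
  rewrite big_ord_recr /= subnn mulr1; congr (_ + _).
  rewrite mulmx_sumr mulmx_suml summxE big_mkord; apply: eq_bigr => i _.
  rewrite !mulmxA tE mul_scalar_mx -!scalemxAl mxE; congr (_ * _).
  by rewrite -[in RHS](subnSK (ltn_ord i)).
- move=> [|k] //; rewrite ltnS => hk /=.
  by rewrite !(expr_stable_leq M_stable) // ltnW.
- by move=> t0; left=> j; rewrite tE t0 raddf0.
- by move=> t1; right=> j; rewrite tE t1.
Qed.

(** Here p M^k = p N^k, so large powers of M equal N^(n+1) (1 + v eta); the last factor is
    invertible as eta v = 0. *)
Lemma rank_one_update_rank_eq (v : 'cV_n.+1) :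
  (forall j, p *m N ^+ j *m v = 0) ->
  let M := N + v *m p in
  M ^+ n.+2 = M ^+ n.+1 /\ \rank (M ^+ n.+1) = \rank (N ^+ n.+1).
Proof.
move=> t0 M.
have pM k : p *m M ^+ k = p *m N ^+ k.
  elim: k => [//|k IHk]; rewrite !exprSr -!mulmxE !mulmxA IHk mulmxDr.
  by rewrite mulmxA t0 mul0mx addr0.
have etav : eta *m v = 0 by rewrite mulmx_suml big1.
have Mk k : (n.+1 + n.+1 <= k)%N ->
    M ^+ k = N ^+ n.+1 *m (1%:M + v *m eta).
  move=> hk; rewrite exprD_sum -/M.
  rewrite (expr_stable_leq N_stable) ?(leq_trans _ hk) ?leq_addr //.
  rewrite mulmxDr mulmx1; congr (_ + _).
  have hk' : (n.+1 <= k)%N by apply: leq_trans hk; apply: leq_addr.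
  rewrite big_nat_rev /= add0n (big_cat_nat _ hk') //=.
  rewrite [X in _ + X]big1_seq ?addr0; last first.
    move=> i /andP[_]; rewrite mem_index_iota => /andP[h1 h2].
    by rewrite pM subnSK // subKn 1?ltnW // pNk ?mulmx0.
  rewrite mulmxA mulmx_sumr; apply: eq_big_nat => i /andP[_ hi].
  have ik : (i < k)%N by apply: leq_trans hk'.
  rewrite pM subnSK // subKn 1?ltnW // (expr_stable_leq N_stable) //.
  rewrite leq_subRL //; apply: leq_trans hk; by rewrite leq_add2r.
have stab : M ^+ n.+2 = M ^+ n.+1.
  by apply: (@mx_expr_stable _ _ _ (n.+1 + n.+1)); rewrite !Mk // ltnW.
split=> //; rewrite -(expr_stable_leq stab (leq_addr n.+1 n.+1)) Mk //.
apply: mxrankMfree; apply/row_freeP; exists (1%:M - v *m eta).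
rewrite mulmxDl mul1mx mulmxBr mulmx1 -mulmxA (mulmxA eta) etav mul0mx mulmx0.
by rewrite subr0 subrK.
Qed.

Section RankGrows.

Variable v : 'cV[F]_n.+1.
Hypothesis t1 : forall j, p *m N ^+ j *m v = (j == 0%N)%:R%:M.
Let M := N + v *m p.

Let pM (k : nat) : p *m M ^+ k = \sum_(0 <= i < k.+1) p *m N ^+ i.
Proof.
elim: k => [|k IHk]; first by rewrite big_nat1 !expr0.
rewrite exprSr -mulmxE mulmxA IHk [RHS]big_nat_recl // expr0 mulmx1 mulmxDr addrC.
congr (_ + _).
  rewrite mulmxA mulmx_suml big_nat_recl // big1 => [|i _]; last first.
    by rewrite t1 /= mulr0n raddf0.
  by rewrite addr0 t1 mul1mx.
by rewrite mulmx_suml; apply: eq_bigr => i _; rewrite -mulmxA mulmxE -exprSr.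
Qed.

Let pM_eta (k : nat) : (n <= k)%N -> p *m M ^+ k = eta.
Proof.
move=> hk; rewrite pM (@big_cat_nat _ _ _ n.+1) //=.
rewrite [X in _ + X]big1_seq ?addr0 // => i /andP[_].
by rewrite mem_index_iota => /andP[h1 _]; rewrite pNk.
Qed.

(** With P = N^(n+1), stability of M and N gives P v eta = P (M - N) M^(n+1) = 0, and eta is
    nonzero. *)
Lemma rank_one_update_stable_ker :
  M ^+ n.+2 = M ^+ n.+1 -> N ^+ n.+1 *m v = 0.
Proof.
move=> M_stable.
have E : N ^+ n.+1 *m v *m eta = 0.
  rewrite -(pM_eta (leqnSn n)) !mulmxA -(mulmxA _ v) -mulmxA.
  have -> : N ^+ n.+1 *m (v *m p *m M ^+ n.+1) =
            N ^+ n.+1 *m (M *m M ^+ n.+1) - N ^+ n.+1 *m (N *m M ^+ n.+1).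
    by rewrite -mulmxBr -mulmxBl [M - N]addrAC subrr add0r.
  rewrite (mulmxA _ N) !mulmxE -exprS -exprSr M_stable N_stable.
  by rewrite subrr.
have [y ey] := exists_dual_vector0 eta_neq0.
by rewrite -[LHS]mulmx1 -ey mulmxA E mul0mx.
Qed.

(** Large powers of M equal P + nu eta with P = N^(n+1). As P nu = 0, eta P = 0 and eta nu = 1, this
    is a sum of two orthogonal idempotents, the second of rank 1. *)
Lemma rank_one_update_rank_succ : N ^+ n.+1 *m v = 0 ->
  M ^+ n.+2 = M ^+ n.+1 /\ \rank (M ^+ n.+1) = (\rank (N ^+ n.+1)).+1.
Proof.
move=> Pv0.
pose nu := \sum_(0 <= i < n.+1) N ^+ i *m v.
have Mk k : (n.+1 + n.+1 <= k)%N -> M ^+ k = N ^+ n.+1 + nu *m eta.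
  move=> hk; rewrite exprD_sum -/M.
  have hk' : (n.+1 <= k)%N by apply: leq_trans hk; apply: leq_addr.
  rewrite (expr_stable_leq N_stable) //; congr (_ + _).
  rewrite (big_cat_nat _ hk') //= [X in _ + X]big1_seq ?addr0; last first.
    move=> i /andP[_]; rewrite mem_index_iota => /andP[h1 _].
    by rewrite (expr_stable_leq N_stable) // Pv0 mul0mx.
  rewrite mulmx_suml; apply: eq_big_nat => i /andP[_ hi].
  rewrite pM_eta // leq_subRL ?(leq_trans hi) //.
  by apply: leq_trans hk; rewrite leq_add // ltnW.
have stab : M ^+ n.+2 = M ^+ n.+1.
  by apply: (@mx_expr_stable _ _ _ (n.+1 + n.+1)); rewrite !Mk // ltnW.
split=> //; rewrite -(expr_stable_leq stab (leq_addr n.+1 n.+1)) Mk //.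
set P := N ^+ n.+1 in Pv0 *; have etaP : eta *m P = 0 := etaP0.
have PP : P *m P = P.
  by rewrite mulmxE -exprD (expr_stable_leq N_stable) ?leq_addr.
have Pnu : P *m nu = 0.
  rewrite mulmx_sumr big1 // => i _; rewrite mulmxA mulmxE -exprD.
  by rewrite (expr_stable_leq N_stable) ?leq_addr.
have etanu : eta *m nu = 1%:M.
  rewrite mulmx_sumr big_nat_recl // big1 ?addr0 => [|i _]; last first.
    rewrite mulmxA mulmx_suml mulmx_suml big1 // => j _.
    by rewrite -(mulmxA p) mulmxE -exprD t1 addnS /= mulr0n raddf0.
  rewrite expr0 mul1mx mulmx_suml big_nat_recl // big1 => [|i _]; last first.
    by rewrite t1 /= mulr0n raddf0.
  by rewrite t1 addr0.
have -> : \rank (P + nu *m eta)%R = \rank (P + eta)%MS.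
  apply/eqP; rewrite eqn_leq !mxrankS //.
    rewrite addsmx_sub; apply/andP; split; apply/submxP.
      by exists P; rewrite mulmxDr PP mulmxA Pnu mul0mx addr0.
    by exists eta; rewrite mulmxDr etaP mulmxA etanu mul1mx add0r.
  by rewrite addmx_sub_adds // submxMl.
rewrite mxrank_disjoint_sum ?rank_rV ?eta_neq0 ?addn1 //.
apply/eqP; rewrite -submx0; apply/row_subP => i; set x := row i _.
have : (x <= P :&: eta)%MS by exact: row_sub.
rewrite sub_capmx => /andP[/submxP[a xa] /submxP[b xb]].
have -> : x = x *m P by rewrite {2}xa -mulmxA PP.
by rewrite xb -mulmxA etaP mulmx0 sub0mx.
Qed.

End RankGrows.

(** N acts nilpotently on the span A of all p N^j, so p lies outside A N, the span of the p N^j with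
    j > 0; take a vector dual to p that kills A N. *)
Lemma exists_dual_of_cyclic : exists v : 'cV_n.+1,
  N ^+ n.+1 *m v = 0 /\ forall j, p *m N ^+ j *m v = (j == 0%N)%:R%:M.
Proof.
pose A := \matrix_(j < n.+1) (p *m N ^+ j).
have AK : A *m N ^+ n.+1 = 0.
  apply/row_matrixP => j; rewrite row_mul rowK row0 -mulmxA mulmxE -exprD.
  by rewrite pNk // leq_addl.
have rowAN j : (p *m N ^+ j.+1 <= A *m N)%MS.
  case: (ltnP j n.+1) => hj; last by rewrite pNk ?sub0mx // ltnW.
  have -> : p *m N ^+ j.+1 = row (Ordinal hj) (A *m N).
    by rewrite row_mul rowK -mulmxA mulmxE -exprSr.
  exact: row_sub.
have [|v0 AN0 pv0] := @exists_dual_vector _ _ _ (A *m N) p.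
  apply: contra p_neq0 => pAN.
  have /submxP [D AD] : (A <= A *m N)%MS.
    apply/row_subP => j; rewrite rowK; case: {j}(nat_of_ord j) => [|j //].
    by rewrite expr0 mulmx1.
  have E k : A = D ^+ k *m (A *m N ^+ k).
    elim: k => [|k IHk]; first by rewrite !expr0 mul1mx mulmx1.
    by rewrite {1}IHk {1}AD exprSr exprS -!mulmxE !mulmxA.
  have A0 : A = 0 by rewrite (E n.+1) AK mulmx0.
  have <- : row ord0 A = p by rewrite rowK expr0 mulmx1.
  by rewrite A0 row0.
(* Projecting off the image of [N ^+ n.+1] leaves every p N^j v unchanged. *)
exists (v0 - N ^+ n.+1 *m v0); split.
  rewrite mulmxBr mulmxA mulmxE -exprD.
  by rewrite (expr_stable_leq N_stable (leq_addr _ _)) subrr.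
move=> j; rewrite mulmxBr [X in _ - X](_ : _ = 0) ?subr0; last first.
  by rewrite mulmxA -(mulmxA p) mulmxE -exprD pNk ?mul0mx ?leq_addl.
case: j => [|j]; first by rewrite expr0 mulmx1.
have /submxP [D ->] := rowAN j.
by rewrite -mulmxA AN0 mulmx0 /= mulr0n raddf0.
Qed.

End RankOneUpdate.

(** Unless p M^(n+1) = 0 already, pick v fixed by M with p v = 1 and subtract v p. Then N v = 0, so
    N^(k+1) = N M^k, while p N = p (M - 1) is killed by M^(n+1). *)
Lemma exists_nilpotent_base (F : fieldType) (n : nat) (M : 'M[F]_n.+1)
    (p : 'rV_n.+1) : M ^+ n.+2 = M ^+ n.+1 ->
  exists w : 'cV_n.+1, let N := M + w *m p in
    N ^+ n.+2 = N ^+ n.+1 /\ p *m N ^+ n.+1 = 0.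
Proof.
move=> M_stable; case: (eqVneq (p *m M ^+ n.+1) 0) => [pM|pM].
  by exists 0; rewrite mul0mx addr0.
have [v0 pv0] := exists_dual_vector0 pM.
pose v := M ^+ n.+1 *m v0.
have Mv k : M ^+ k *m v = v.
  rewrite /v mulmxA mulmxE -exprD.
  by rewrite (expr_stable_leq M_stable) ?leq_addl.
have pv : p *m v = 1%:M by rewrite /v mulmxA.
exists (- v); rewrite mulNmx; set N := M - v *m p => /=.
have Nv : N *m v = 0.
  by rewrite mulmxBl -{1}[M]expr1 Mv -mulmxA pv mulmx1 subrr.
have Nk k : N ^+ k.+1 = N *m M ^+ k.
  elim: k => [|k IHk]; first by rewrite expr0 mulmx1 expr1.
  have MkN : M ^+ k *m N = M ^+ k.+1 - v *m p.
    by rewrite mulmxBr mulmxA Mv mulmxE -exprSr.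
  by rewrite exprSr IHk -mulmxE -mulmxA MkN mulmxBr (mulmxA N) Nv mul0mx subr0.
have stab : N ^+ n.+2 = N ^+ n.+1.
  by apply: (@mx_expr_stable _ _ _ n.+2); rewrite !Nk M_stable.
split=> //; rewrite -stab Nk mulmxA.
have -> : p *m N = p *m M - p.
  by rewrite mulmxBr mulmxA pv mul1mx.
by rewrite mulmxBl -mulmxA mulmxE -exprS M_stable subrr.
Qed.

(** * The coefficients and their cancellation along lines *)

Section Coefficients.

Variables (F : finFieldType) (R : pzRingType) (q' : R).
Hypothesis q'K : #|F|%:R * q' = 1.

(* The solution of q^b * weight b = - weight b.+1 with weight m = 1, where
   q' stands for 1/q. *)
Definition weight (m b : nat) : R :=
  (-1) ^+ (m - b) * q' ^+ (\sum_(b <= i < m) i).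

Lemma weight_rec (m b : nat) : (b < m)%N ->
  weight m b *+ (#|F| ^ b) = - weight m b.+1.
Proof.
move=> bm; rewrite /weight big_ltn // -(subnSK bm) exprS mulN1r mulNr mulNrn.
congr (- _); rewrite -mulrnAr; congr (_ * _); rewrite exprD -mulrnAl.
suff -> : q' ^+ b *+ (#|F| ^ b) = 1 by rewrite mul1r.
elim: b {bm} => [|b IHb]; first by rewrite expr0 expn0.
by rewrite exprSr expnSr mulrnA -mulrnAl IHb mul1r -mulr_natl.
Qed.

(** The size is m = n+1; for stable M, the rank of M^(n+1) is the size of the identity block. *)
Definition mx_coef (n : nat) (M : 'M[F]_n.+1) : R :=
  if M ^+ n.+2 == M ^+ n.+1 then weight n.+1 (\rank (M ^+ n.+1)) else 0.

Lemma mx_coef1 (n : nat) : mx_coef (1 : 'M[F]_n.+1) = 1.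
Proof.
rewrite /mx_coef !expr1n eqxx mxrank1 /weight subnn big_geq //.
by rewrite !expr0 mulr1.
Qed.

Lemma mx_coef_unit (n : nat) (M : 'M[F]_n.+1) :
  M \is a GRing.unit -> M != 1 -> mx_coef M = 0.
Proof.
move=> uM M1; rewrite /mx_coef exprS; case: eqP => // E.
case/eqP: M1; apply: (@mulIr _ (M ^+ n.+1)); first by rewrite unitrX.
by rewrite E mul1r.
Qed.

(** Put P = N^(n+1), an idempotent. [S0] contains the image of P, which has q^b elements, and is its
    direct sum with the part of [S0] killed by P; that part is [S1] translated by -v1. *)
Lemma card_cyclic_annihilators (n : nat) (N : 'M[F]_n.+1) (p : 'rV_n.+1)
    (v1 : 'cV_n.+1) (S0 S1 : {set 'cV[F]_n.+1}) :
  N ^+ n.+2 = N ^+ n.+1 -> p *m N ^+ n.+1 = 0 ->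
  (forall v, reflect (forall j, p *m N ^+ j *m v = 0) (v \in S0)) ->
  (forall v, reflect (N ^+ n.+1 *m v = 0 /\
      forall j, p *m N ^+ j *m v = (j == 0%N)%:R%:M) (v \in S1)) ->
  v1 \in S1 -> #|S0| = (#|S1| * #|F| ^ \rank (N ^+ n.+1))%N.
Proof.
move=> N_stable pN0 S0P S1P v1S.
set P := N ^+ n.+1 in pN0 S1P *; set b := \rank P.
have PP : P *m P = P.
  by rewrite mulmxE -exprD (expr_stable_leq N_stable (leq_addr _ _)).
have pNP j : p *m N ^+ j *m P = 0.
  rewrite -mulmxA mulmxE -exprD addnC exprD -mulmxE mulmxA.
  by rewrite pN0 mul0mx.
pose C := col_base P.
have PC : P *m C = C.
  apply: (row_free_inj (row_base_free P)).
  by rewrite -mulmxA mulmx_base PP.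
have pNC j : p *m N ^+ j *m C = 0 by rewrite -PC mulmxA pNP mul0mx.
have [C' C'C] := row_fullP (col_base_full P).
have [Pv1 pv1] := S1P _ v1S.
pose g (sz : 'cV[F]_n.+1 * 'cV[F]_b) := sz.1 - v1 + C *m sz.2.
have -> : S0 = g @: setX S1 setT.
  apply/setP => v; apply/S0P/imsetP => [pv|[[s z]]].
    exists (v1 + v - P *m v, row_base P *m v).
      rewrite inE /= andbC inE; apply/S1P; split.
        by rewrite mulmxBr mulmxDr Pv1 mulmxA PP add0r subrr.
      by move=> j; rewrite mulmxBr mulmxDr pv1 pv mulmxA pNP mul0mx subr0 addr0.
    by rewrite /g /= mulmxA mulmx_base addrAC subrK addrC addKr.
  rewrite inE /= andbC inE => /S1P [Ps ps] -> j; rewrite /g /=.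
  by rewrite mulmxDr mulmxBr ps pv1 subrr add0r mulmxA pNC mul0mx.
rewrite card_in_imset; first by rewrite cardsX cardsT card_mx muln1.
move=> [s z] [s' z']; rewrite !inE /= !andbT => /S1P [Ps _] /S1P [Ps' _].
rewrite /g /= => E.
have zz : z = z'.
  have := congr1 (mulmx P) E; rewrite !mulmxDr !mulmxN Ps Ps' Pv1 !(mulmxA P C) PC.
  by move=> /addrI /(congr1 (mulmx C')); rewrite !(mulmxA C' C) C'C !mul1mx.
by move: E; rewrite zz => /addIr /addIr ->.
Qed.

Lemma sum_mx_coef_line (n : nat) (M0 : 'M[F]_n.+1) (p : 'rV_n.+1) : p != 0 ->
  \sum_(w : 'cV_n.+1) mx_coef (M0 + w *m p) = 0.
Proof.
move=> p0; pose good M := M ^+ n.+2 == M ^+ n.+1 :> 'M[F]_n.+1.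
case: (pickP (fun w => good (M0 + w *m p))) => [w1 /eqP good1|nogood]; last first.
  by rewrite big1 // => w _; rewrite /mx_coef [_ == _]nogood.
have [w2 /= []] := exists_nilpotent_base p good1.
rewrite -addrA -mulmxDl; move: (w1 + w2) => w0 {w1 w2 good1}.
rewrite (reindex_inj (addrI w0)) /=.
under eq_bigr => w _ do rewrite mulmxDl addrA.
move: (M0 + w0 *m p) => N N_stable pN0 {M0 w0}.
have pNk j : (n.+1 <= j)%N -> p *m N ^+ j = 0.
  by move=> hj; rewrite (expr_stable_leq N_stable).
(* Bounding j by n+1 makes membership decidable; p N^j = 0 beyond. *)
pose S0 := [set v : 'cV[F]_n.+1 | [forall j : 'I_n.+1, p *m N ^+ j *m v == 0]].
pose S1 := [set v : 'cV[F]_n.+1 | (N ^+ n.+1 *m v == 0) &&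
  [forall j : 'I_n.+1, p *m N ^+ j *m v == (j == 0%N :> nat)%:R%:M]].
have S0P v : reflect (forall j, p *m N ^+ j *m v = 0) (v \in S0).
  rewrite inE; apply: (iffP forallP) => pv j; last by rewrite pv.
  case: (ltnP j n.+1) => hj; first exact: eqP (pv (Ordinal hj)).
  by rewrite pNk ?mul0mx.
have S1P v : reflect (N ^+ n.+1 *m v = 0 /\
    forall j, p *m N ^+ j *m v = (j == 0%N)%:R%:M) (v \in S1).
  rewrite inE; apply: (iffP andP) => [[/eqP Pv /forallP pv]|[-> pv]].
    split=> // j; case: (ltnP j n.+1) => hj; first exact: eqP (pv (Ordinal hj)).
    by case: j hj => // j hj; rewrite pNk // mul0mx mulr0n raddf0.
  by split=> //; apply/forallP => j; rewrite pv.
set b := \rank (N ^+ n.+1).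
(* For v outside both sets the update is not stable, by the dichotomy. *)
have coefE v : mx_coef (N + v *m p) =
    (if v \in S0 then weight n.+1 b else 0) +
    (if v \in S1 then weight n.+1 b.+1 else 0).
  case: S0P => [v0|v0].
    have [st rk] := rank_one_update_rank_eq N_stable pN0 v0.
    rewrite /mx_coef st eqxx rk; case: S1P => [[_ /(_ 0%N)]|]; last by rewrite addr0.
    by rewrite v0 => /matrixP/(_ 0 0)/eqP; rewrite !mxE eq_sym oner_eq0.
  rewrite add0r; case: S1P => [[Pv v1]|v1].
    have [st rk] := rank_one_update_rank_succ N_stable pN0 p0 v1 Pv.
    by rewrite /mx_coef st eqxx rk.
  rewrite /mx_coef; case: eqP => // st.
  case: (rank_one_update_dichotomy N_stable pN0 st) => // t1.
  by case: v1; split=> //; exact: rank_one_update_stable_ker st.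
have [v1 v1P] := exists_dual_of_cyclic N_stable pN0 p0.
(* The update by v1 has stable rank b+1, which is at most n+1. *)
have bn : (b < n.+1)%N.
  have [_ rk] := rank_one_update_rank_succ N_stable pN0 p0 v1P.2 v1P.1.
  by rewrite -rk rank_leq_row.
under eq_bigr => v _ do rewrite coefE.
rewrite big_split /= -!big_mkcond !sumr_const.
have := card_cyclic_annihilators N_stable pN0 S0P S1P (introT (S1P _) v1P).
rewrite -/b => ->.
by rewrite mulnC mulrnA weight_rec // mulNrn addNr.
Qed.

End Coefficients.

(** If p X = 0, then M and M + w p act alike on X. Averaging over w brings in the vanishing line
    sums, and q^(n+1) can be cancelled. *)
Lemma sum_mx_coef_act (F : finFieldType) (R : pzRingType) (q' : R)
    (B : lmodType R) (n k : nat) (f : 'M[F]_(n.+1, k) -> B) (X : 'M_(n.+1, k)) :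
  #|F|%:R * q' = 1 -> q' * #|F|%:R = 1 -> (k < n.+1)%N ->
  \sum_(M : 'M_n.+1) mx_coef q' M *: f (M *m X) = 0.
Proof.
move=> qK q'K kn; set S := \sum_M _.
have [p /sub_kermxP pX p0] : exists2 p : 'rV_n.+1, (p <= kermx X)%MS & p != 0.
  apply/rowV0Pn; rewrite kermx_eq0 /row_free neq_ltn.
  by rewrite (leq_ltn_trans (rank_leq_col X) kn).
have S0 : S *+ (#|F| ^ n.+1) = 0.
  rewrite -[n.+1]muln1 -card_mx -sumr_const.
  under eq_bigr => w _.
    rewrite /S (reindex_inj (addIr (w *m p))) /=.
    under eq_bigr => M _ do rewrite mulmxDl -(mulmxA w) pX mulmx0 addr0.
    over.
  rewrite exchange_big big1 //= => M _.
  by rewrite -scaler_suml sum_mx_coef_line // scale0r.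
elim: (n.+1) S0 => [|j IHj]; first by rewrite expn0.
rewrite expnSr mulrnA => /(congr1 ( *:%R q')).
by rewrite -scaler_nat scalerA q'K scale1r scaler0 => /IHj.
Qed.

(** * Descending to matrices of rank at most k *)

Lemma mx_factor_through (F : fieldType) (m n r : nat) (M : 'M[F]_(m, n)) :
  (\rank M <= r)%N -> exists (A : 'M_(m, r)) (C : 'M_(r, n)), M = A *m C.
Proof.
move=> rM; exists (col_ebase M *m pid_mx (\rank M)).
exists (pid_mx (\rank M) *m row_ebase M).
rewrite !mulmxA -(mulmxA (col_ebase M)) mul_pid_mx minnn (minn_idPr rM).
by rewrite mulmx_ebase.
Qed.

Section Generation.

Variables (F : finFieldType) (R : pzRingType) (B : lmodType R) (m k : nat).

(** The list is chosen before [f] and [X]: this is the uniformity of the generation. *)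
Definition low_rank_combination
    (h : ('M[F]_(m, k) -> B) -> 'M[F]_(m, k) -> B) : Prop :=
  exists2 s : seq (R * 'M[F]_m), all (fun z => \rank z.2 <= k)%N s &
    forall f X, h f X = \sum_(z <- s) z.1 *: f (z.2 *m X).

Lemma low_rank_combination_sum (I : eqType) (s : seq I) (c : I -> R)
    (h : I -> ('M[F]_(m, k) -> B) -> 'M[F]_(m, k) -> B) :
  (forall i, i \in s -> c i != 0 -> low_rank_combination (h i)) ->
  low_rank_combination (fun f X => \sum_(i <- s) c i *: h i f X).
Proof.
elim: s => [|i s IHs] hs.
  by exists [::] => // f X; rewrite !big_nil.
have [|s1 rk1 E1] := IHs.
  by move=> j js; apply: hs; rewrite inE js orbT.
case: (eqVneq (c i) 0) => [ci0|ci0].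
  by exists s1 => // f X; rewrite big_cons ci0 scale0r add0r E1.
have [s2 rk2 E2] := hs i (mem_head _ _) ci0.
exists ([seq (c i * z.1, z.2) | z <- s2] ++ s1).
  by rewrite all_cat rk1 andbT all_map.
move=> f X; rewrite big_cons big_cat big_map E1 E2 scaler_sumr; congr (_ + _).
by apply: eq_bigr => z _; rewrite scalerA.
Qed.

Hypothesis hF : invertible (#|F|%:R : R).

Lemma low_rank_combination_mul (M : 'M[F]_m) :
  low_rank_combination (fun f X => f (M *m X)).
Proof.
have [q' [qK q'K]] := hF.
have [r] := ubnPleq (\rank M); elim: r M => [|r IHr] M rM.
  exists [:: (1, M)] => /=; first by rewrite andbT (leq_trans rM).
  by move=> f X; rewrite big_seq1 scale1r.
case: (leqP (\rank M) k) => [Mk|kM].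
  exists [:: (1, M)] => /=; first by rewrite andbT.
  by move=> f X; rewrite big_seq1 scale1r.
have [A [C MAC]] := mx_factor_through rM.
have kr : (k < r.+1)%N by apply: leq_trans rM.
(* With M = A C and inner size r+1, the relation for Y -> f (A Y) at C X is solved for its term N =
   1. The other N with nonzero coefficient are singular, so A N C has rank at most r. *)
pose c (N : 'M[F]_r.+1) := if N == 1 then 0 else - mx_coef q' N.
have [|s rks E] := @low_rank_combination_sum _ (index_enum 'M[F]_r.+1) c
    (fun N f X => f (A *m N *m C *m X)).
  move=> N _; rewrite /c; case: (eqVneq N 1) => [_|N1]; first by rewrite eqxx.
  rewrite oppr_eq0 => cN; apply: IHr; rewrite -ltnS.
  apply: leq_ltn_trans (mxrankM_maxl _ _) _.
  apply: leq_ltn_trans (mxrankM_maxr _ _) _.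
  rewrite ltn_neqAle rank_leq_row andbT; apply: contraNneq cN => rN.
  rewrite mx_coef_unit //.
  by have : row_free N by [rewrite /row_free rN]; rewrite row_free_unit.
exists s => // f X; rewrite -E.
have := @sum_mx_coef_act F R q' B r k (fun Y => f (A *m Y)) (C *m X) qK q'K kr.
rewrite (bigD1 1) //= mx_coef1 scale1r mul1mx mulmxA => /eqP.
rewrite addr_eq0 -MAC => /eqP ->; rewrite -sumrN [RHS](bigD1 1) //=.
rewrite {1}/c eqxx scale0r add0r; apply: eq_bigr => N /negPf N1.
by rewrite /c N1 scaleNr !mulmxA.
Qed.

End Generation.

(** * From matrices to term operations and minors *)

Lemma factors_through_mx (F : fieldType) (V : lmodType F) (m l n : nat)
    (M : 'M[F]_(l, m)) : (\rank M <= n)%N ->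
  @factors_through (module_algebra F V) n m l
    (fun x => [ffun i => \sum_j M i j *: x j]).
Proof.
move=> /mx_factor_through [A [C ->]].
exists (fun x : {ffun 'I_m -> V} => [ffun i => \sum_j C i j *: x j]).
exists (fun y : {ffun 'I_n -> V} => [ffun i => \sum_j A i j *: y j]).
split=> [i|i|x].
- by apply/term_operation_moduleP; exists (C i) => x; rewrite ffunE.
- by apply/term_operation_moduleP; exists (A i) => x; rewrite ffunE.
apply/ffunP => i; rewrite !ffunE.
under eq_bigr => j _ do rewrite mxE scaler_suml.
rewrite exchange_big; apply: eq_bigr => a _; rewrite ffunE scaler_sumr.
by apply: eq_bigr => j _; rewrite scalerA.
Qed.

Theorem theorem49 (F : finFieldType) (k : nat) (hk : (0 < k)%N)
    (R : pzRingType) (B : lmodType R) (hF : invertible (#|F|%:R : R)) :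
  uniformly_generated (module_algebra F 'rV[F]_k) (module_algebra R B) k
    (all_operations 'rV[F]_k B).
Proof.
move=> m _.
have [s0 rk0 E0] := low_rank_combination_mul B k hF (1%:M : 'M_m).
(* The dummy term makes the arity of s positive even if s0 is empty. *)
pose s := (0, 0) :: s0.
have rks : all (fun z => \rank z.2 <= k)%N s by rewrite /= mxrank0.
have E (f : 'M_(m, k) -> B) X : f X = \sum_(z <- s) z.1 *: f (z.2 *m X).
  by rewrite big_cons scale0r add0r -E0 mul1mx.
pose z (j : 'I_(size s)) := nth (0, 0) s j.
exists (size s), (fun y : {ffun 'I_(size s) -> B} => \sum_j (z j).1 *: y j).
exists (fun j x => [ffun i => \sum_l (z j).2 i l *: x l]).
split=> [//||j|f _ x].
- by apply/term_operation_moduleP; exists (fun j => (z j).1).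
- by apply: factors_through_mx; apply: (allP rks); apply: mem_nth.
(* The i-th argument of [f] becomes the i-th row of a matrix. *)
have := E (fun Y => f [ffun i => row i Y]) (\matrix_i x i).
rewrite (big_nth (0, 0)) big_mkord => H.
have -> : x = [ffun i => row i (\matrix_i x i)].
  by apply/ffunP => i; rewrite ffunE rowK.
rewrite {1}H; apply: eq_bigr => j _; rewrite ffunE; congr (_ *: f _).
apply/ffunP => i; rewrite !ffunE row_mul mulmx_sum_row.
by apply: eq_bigr => l _; rewrite !ffunE mxE.
Qed.
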